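(* If $P_T=\sum_{i=1}^\infty\int_0^TZ_{i,T}(s)\,\mathrm ds$ and $Q_T=\sum_{i=1}^\infty\int_0^T\mathcal Z_{i,T}(s)\,\mathrm ds$ exist, then $Q_T$ satisfies $$\sum_{i=1}^\infty\mathcal Z_{i,T}(T)-C^\top C=\mathcal L^*(Q_T)+\mathcal H(P_T\otimes Q_T)\mathcal H^\top.$$ If $\sigma\big(A\otimes I+I\otimes A+\sum_{k=1}^mN_k\otimes N_k\big)\subset\mathbb C_-$, $P=\sum_{i=1}^\infty\int_0^\infty Z_{i,\infty}(s)\,\mathrm ds$ exists and $Q=\sum_{i=1}^\infty\int_0^\infty\mathcal Z_{i,\infty}(s)\,\mathrm ds$ is well-defined, then $Q$ is a solution of $$-C^\top C=\mathcal L^*(Q)+\mathcal H(P\otimes Q)\mathcal H^\top.$$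
   Context: Setting: $n,m,p\in\mathbb N$, $T>0$, $A\in\mathbb R^{n\times n}$, $B\in\mathbb R^{n\times m}$, $C\in\mathbb R^{p\times n}$, $N=[N_1\ \dots\ N_m]$, $H=[H_1\ \dots\ H_n]$ with $N_k,H_j\in\mathbb R^{n\times n}$, and block-wise transposes $\mathcal N=[N_1^\top\ \dots\ N_m^\top]$, $\mathcal H=[H_1^\top\ \dots\ H_n^\top]$; $\otimes$ is the Kronecker product; $\sigma(\cdot)$ is the spectrum and $\mathbb C_-$ the open left half-plane. Reachability: $\mathcal L(X)=AX+XA^\top+N(I\otimes X)N^\top$. $Z_{1,T}$ solves $\dot Z_{1,T}=\mathcal L(Z_{1,T})$ on $[0,\infty)$, $Z_{1,T}(0)=BB^\top$, and for $i\ge2$, $\dot Z_{i,T}=\mathcal L(Z_{i,T})$, $Z_{i,T}(0)=H\big(\sum_{k=1}^{i-1}\int_0^TZ_{k,T}(s)\,\mathrm ds\otimes\int_0^TZ_{i-k,T}(s)\,\mathrm ds\big)H^\top$. Observability: $\mathcal L^*(X)=A^\top X+XA+\mathcal N(I\otimes X)\mathcal N^\top$. $\mathcal Z_{1,T}$ solves $\dot{\mathcal Z}_{1,T}=\mathcal L^*(\mathcal Z_{1,T})$, $\mathcal Z_{1,T}(0)=C^\top C$, and for $i\ge2$, $\dot{\mathcal Z}_{i,T}=\mathcal L^*(\mathcal Z_{i,T})$, $\mathcal Z_{i,T}(0)=\mathcal H\big(\sum_{k=1}^{i-1}\int_0^TZ_{k,T}(s)\,\mathrm ds\otimes\int_0^T\mathcal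 Z_{i-k,T}(s)\,\mathrm ds\big)\mathcal H^\top$. $Z_{i,\infty}$ and $\mathcal Z_{i,\infty}$ are defined in the same way with $T$ replaced by $\infty$ in the initial values. A Gramian ''exists''/''is well-defined'' if the defining series (and improper integrals) converge. *)

(* Defs.v *)
From HB Require Import structures.
From mathcomp Require Import all_boot all_order all_algebra.
From mathcomp Require Import all_classical all_reals all_analysis.
From mathcomp Require Import complex.
From mathcomp Require Export mxtens.

Set Implicit Arguments.
Unset Strict Implicit.
Unset Printing Implicit Defensive.

Import Order.TTheory GRing.Theory Num.Theory.
Import numFieldNormedType.Exports.
Local Open Scope classical_set_scope.
Local Open Scope ring_scope.

(* [M_0 ... M_(k-1)]; columns are indexed through mxtens_unindex so that the
   product with a Kronecker product [*t] typechecks without casts. *)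
Definition block_row (R : realType) (n k : nat) (M : 'I_k -> 'M[R]_n) :
    'M[R]_(n, k * n) :=
  \matrix_(i, j) M (mxtens_unindex j).1 i (mxtens_unindex j).2.

Definition block_tr (R : realType) (n k : nat) (M : 'I_k -> 'M[R]_n) :
    'M[R]_(n, k * n) :=
  block_row (fun l => (M l)^T).

Definition reach_op (R : realType) (n m : nat) (A : 'M[R]_n)
    (N : 'I_m -> 'M[R]_n) (X : 'M[R]_n) : 'M[R]_n :=
  A *m X + X *m A^T
  + block_row N *m ((1%:M : 'M[R]_m) *t X) *m (block_row N)^T.

Definition obs_op (R : realType) (n m : nat) (A : 'M[R]_n)
    (N : 'I_m -> 'M[R]_n) (X : 'M[R]_n) : 'M[R]_n :=
  A^T *m X + X *m A
  + block_tr N *m ((1%:M : 'M[R]_m) *t X) *m (block_tr N)^T.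

(* Z' = F(Z) on [0, +oo[ with Z(0) = X0; the equation at the end point 0 is
   implied by continuity there. Values of Z at negative times are irrelevant. *)
Definition solves_ivp (R : realType) (n : nat) (F : 'M[R]_n -> 'M[R]_n)
    (X0 : 'M[R]_n) (Z : R -> 'M[R]_n) : Prop :=
  [/\ Z 0 = X0,
      {within `[0, +oo[%classic, continuous Z}
    & forall t : R, 0 < t -> is_derive t 1 Z (F (Z t))].

Definition int_to (R : realType) (n : nat) (T : R) (Z : R -> 'M[R]_n) :
    'M[R]_n :=
  \matrix_(i, j) \int[lebesgue_measure]_(s in `[0, T]%classic) Z s i j.

Definition int_infty_cvg (R : realType) (n : nat) (Z : R -> 'M[R]_n) : Prop :=
  cvg (int_to T Z @[T --> +oo%R]).

(* Meaningful only under [int_infty_cvg Z]. *)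
Definition int_infty (R : realType) (n : nat) (Z : R -> 'M[R]_n) : 'M[R]_n :=
  lim (int_to T Z @[T --> +oo%R]).

(* Z i is Z_i for i >= 1, Z 0 is irrelevant. The time integration J entering
   the initial values is [int_to T] or [int_infty]. *)
Definition reach_terms (R : realType) (n m : nat) (A : 'M[R]_n)
    (B : 'M[R]_(n, m)) (N : 'I_m -> 'M[R]_n) (H : 'I_n -> 'M[R]_n)
    (J : (R -> 'M[R]_n) -> 'M[R]_n) (Z : nat -> R -> 'M[R]_n) : Prop :=
  solves_ivp (reach_op A N) (B *m B^T) (Z 1%N) /\
  forall i : nat, (2 <= i)%N ->
    solves_ivp (reach_op A N)
      (block_row H *m (\sum_(1 <= k < i) (J (Z k) *t J (Z (i - k)%N)))
        *m (block_row H)^T)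
      (Z i).

Definition obs_terms (R : realType) (n m p : nat) (A : 'M[R]_n)
    (C : 'M[R]_(p, n)) (N : 'I_m -> 'M[R]_n) (H : 'I_n -> 'M[R]_n)
    (J : (R -> 'M[R]_n) -> 'M[R]_n) (Z W : nat -> R -> 'M[R]_n) : Prop :=
  solves_ivp (obs_op A N) (C^T *m C) (W 1%N) /\
  forall i : nat, (2 <= i)%N ->
    solves_ivp (obs_op A N)
      (block_tr H *m (\sum_(1 <= k < i) (J (Z k) *t J (W (i - k)%N)))
        *m (block_tr H)^T)
      (W i).

(* The series of u_1, u_2, u_3, and so on converges, with sum S. *)
Definition is_sum (R : realType) (n : nat) (u : nat -> 'M[R]_n) (S : 'M[R]_n) :
    Prop :=
  (\sum_(1 <= i < k.+1) u i) @[k --> \oo] --> S.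

Definition spectrum (R : realType) (n : nat) (M : 'M[R]_n) : set R[i] :=
  [set z | eigenvalue (map_mx (real_complex R) M) z].

Definition open_left_half_plane (R : realType) : set R[i] :=
  [set z | complex.Re z < 0].

(* Main.v *)
Require Import Defs.
From HB Require Import structures.
From mathcomp Require Import all_boot all_order all_algebra.
From mathcomp Require Import all_classical all_reals all_analysis.
From mathcomp Require Import ring lra.

Set Implicit Arguments.
Unset Strict Implicit.
Unset Printing Implicit Defensive.

Import Order.TTheory GRing.Theory Num.Theory.
Import numFieldNormedType.Exports.
Local Open Scope classical_set_scope.
Local Open Scope ring_scope.

(** Why the identities hold.  Integrating the linear equation of one term gives
[W_i(T) = W_i(0) + L*(J W_i)], where [L*] is [obs_op A N] and [J] is integration
over [0, T].  Over an infinite horizon the left-hand side tends to a limit, and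
the limit is 0 because the integral of [W_i] converges.  Summing over [i], the
last term contributes [L*(Q)], so that everything rests on the initial values:
[W_1(0) = C^T C], and the others are the images under
[X |-> Hc X Hc^T], with [Hc = block_tr H], of the terms of the Cauchy product of
the series of [J Z_k] and [J W_l].  The sum of that product must be shown to
exist and to be [P *t Q].

Convergence of the two series alone does not give convergence of their Cauchy
product; positivity does.  All [J Z_k] and [J W_l] are positive semidefinite,
the entries of such a matrix are bounded by its trace, and the traces sum up, so
both series converge absolutely ([is_sum_tens], from [cauchy_product_sum]).

Positivity is proved along the recursion.  An initial value is positive
semidefinite because [Hc (X *t Y) Hc^T] is so when [X] and [Y] are
([psd_block_row_tens]: write [X] as a sum of squares).  The flow of [L*] and of
its primal counterpart preserves symmetry and nonnegativity of the quadratic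
form ([reach_flow_psd]).  Both facts come from one comparison principle,
[ivp_comparison]: a family of linear inequalities that one Euler step preserves
up to a factor [1 + h l] and an error of order [h ^ 2] is preserved by the flow.
For the quadratic form the Euler step is
[Y + h L(Y) = (1 + h A) Y (1 + h A)^T + h * sum_k N_k Y N_k^T - h^2 A Y A^T],
where only the last term can be negative. *)

(** * The generalized Lyapunov operators *)

Lemma mxtens_sum (R : realType) (m n : nat) (f : 'I_(m * n) -> R) :
  \sum_k f k = \sum_i \sum_j f (mxtens_index (i, j)).
Proof.
rewrite pair_big /= (reindex (@mxtens_index m n)) /=; last first.
  exists (@mxtens_unindex m n) => ij _; first exact: mxtens_indexK.
  exact: mxtens_unindexK.
by apply: eq_bigr => -[].
Qed.

(** Every later computation with [N] and [H] goes through this form, which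
trades the Kronecker product for products of [n x n] matrices. *)
Lemma block_row_tens (R : realType) (n k : nat) (M : 'I_k -> 'M[R]_n)
    (X : 'M[R]_k) (Y : 'M[R]_n) :
  block_row M *m (X *t Y) *m (block_row M)^T
  = \sum_i \sum_j X i j *: (M i *m Y *m (M j)^T).
Proof.
apply/matrixP => a b; rewrite mxE mxtens_sum summxE.
under [RHS]eq_bigr do rewrite summxE.
rewrite [RHS]exchange_big /=; apply: eq_bigr => j _.
under eq_bigr => l _.
  rewrite 3!mxE mxtens_sum mxtens_indexK mulr_suml /=.
  under eq_bigr => i _.
    rewrite mulr_suml.
    under eq_bigr => r _ do rewrite tensmxE mxE mxtens_indexK /=.
    over.
  over.
rewrite exchange_big; apply: eq_bigr => i _ /=.
rewrite mxE mxE mulr_sumr; apply: eq_bigr => l _.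
rewrite !mxE mulr_suml mulr_sumr.
by apply: eq_bigr => r _; ring.
Qed.

Lemma reach_opE (R : realType) (n m : nat) (A : 'M[R]_n)
    (N : 'I_m -> 'M[R]_n) (X : 'M[R]_n) :
  reach_op A N X
  = A *m X + X *m A^T + \sum_k N k *m X *m (N k)^T.
Proof.
rewrite /reach_op block_row_tens; congr (_ + _); apply: eq_bigr => k _.
rewrite (bigD1 k) //= mxE eqxx scale1r big1 ?addr0 // => l /negPf lk.
by rewrite mxE eq_sym lk scale0r.
Qed.

(** The observability operator is a reachability operator for transposed data,
so that the flow is studied only once. *)
Lemma obs_op_dual (R : realType) (n m : nat) (A : 'M[R]_n)
    (N : 'I_m -> 'M[R]_n) :
  obs_op A N = reach_op A^T (fun k => (N k)^T).
Proof. by rewrite /obs_op /reach_op trmxK. Qed.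

Lemma reach_op_is_linear (R : realType) (n m : nat) (A : 'M[R]_n)
    (N : 'I_m -> 'M[R]_n) : linear (reach_op A N).
Proof.
move=> c X Y; rewrite !reach_opE.
rewrite !mulmxDr !mulmxDl -!scalemxAr -!scalemxAl !scalerDr.
under eq_bigr do rewrite mulmxDr mulmxDl -scalemxAr -scalemxAl.
rewrite big_split /= -scaler_sumr [RHS]addrACA.
by congr (_ + _); rewrite addrACA.
Qed.

HB.instance Definition _ (R : realType) (n m : nat) (A : 'M[R]_n)
    (N : 'I_m -> 'M[R]_n) :=
  GRing.isLinear.Build R 'M[R]_n 'M[R]_n *:%R (reach_op A N)
    (reach_op_is_linear A N).

Lemma reach_op_tr (R : realType) (n m : nat) (A : 'M[R]_n)
    (N : 'I_m -> 'M[R]_n) (X : 'M[R]_n) :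
  (reach_op A N X)^T = reach_op A N X^T.
Proof.
rewrite !reach_opE !linearD /= linear_sum /= !trmx_mul trmxK.
rewrite [_ *m A^T + _]addrC; congr (_ + _).
by apply: eq_bigr => k _; rewrite !trmx_mul trmxK mulmxA.
Qed.

(** * Positive semidefinite matrices *)

Definition qform (R : realType) (n : nat) (v : 'rV[R]_n) (X : 'M[R]_n) : R :=
  (v *m X *m v^T) 0 0.

(** Symmetry is included: without it the quadratic form controls neither single
entries nor Kronecker products. *)
Definition psd (R : realType) (n : nat) (X : 'M[R]_n) : Prop :=
  X^T = X /\ forall v, 0 <= qform v X.

Lemma qform_linear (R : realType) (n : nat) (v : 'rV[R]_n) (a : R)
    (X Y : 'M[R]_n) :
  qform v (a *: X + Y) = a * qform v X + qform v Y.
Proof.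
by rewrite /qform mulmxDr mulmxDl -scalemxAr -scalemxAl mxE [X in X + _]mxE.
Qed.

Lemma qformE (R : realType) (n : nat) (v : 'rV[R]_n) (X : 'M[R]_n) :
  qform v X = \sum_i \sum_j v 0 i * v 0 j * X i j.
Proof.
rewrite /qform mxE exchange_big /=; apply: eq_bigr => j _.
by rewrite !mxE mulr_suml; apply: eq_bigr => i _; ring.
Qed.

Lemma qform_congr (R : realType) (n : nat) (v : 'rV[R]_n) (M X : 'M[R]_n) :
  qform v (M *m X *m M^T) = qform (v *m M) X.
Proof. by rewrite /qform trmx_mul !mulmxA. Qed.

Lemma psdD (R : realType) (n : nat) (X Y : 'M[R]_n) :
  psd X -> psd Y -> psd (X + Y).
Proof.
move=> [sX pX] [sY pY]; split; first by rewrite linearD /= sX sY.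
by move=> v; rewrite -[X]scale1r qform_linear mul1r addr_ge0.
Qed.

Lemma psd0 (R : realType) (n : nat) : psd (0 : 'M[R]_n).
Proof. by split => [|v]; rewrite ?trmx0 // /qform mulmx0 mul0mx mxE. Qed.

Lemma psd_sum (R : realType) (n : nat) (I : Type) (r : seq I) (P : pred I)
    (F : I -> 'M[R]_n) :
  (forall i, P i -> psd (F i)) -> psd (\sum_(i <- r | P i) F i).
Proof. by move=> PF; apply: big_ind => //; [exact: psd0|exact: psdD]. Qed.

Lemma psd_congr (R : realType) (n : nat) (M X : 'M[R]_n) :
  psd X -> psd (M *m X *m M^T).
Proof.
move=> [sX pX]; split; first by rewrite !trmx_mul trmxK sX mulmxA.
by move=> v; rewrite qform_congr.
Qed.

Lemma psd_gram (R : realType) (n k : nat) (M : 'M[R]_(n, k)) : psd (M *m M^T).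
Proof.
split; first by rewrite trmx_mul trmxK.
move=> v; rewrite /qform mulmxA -mulmxA -trmx_mul mxE; apply: sumr_ge0 => i _.
by rewrite [X in _ * X]mxE -expr2 sqr_ge0.
Qed.

Lemma mulmx_deltaT (R : realType) (n : nat) (u : 'rV[R]_n) (j : 'I_n) :
  (u *m (delta_mx 0 j : 'rV_n)^T) 0 0 = u 0 j.
Proof.
rewrite mxE (bigD1 j) //= !mxE !eqxx mulr1 big1 ?addr0 // => k /negPf kj.
by rewrite !mxE kj andbF mulr0.
Qed.

(** Moving along a coordinate axis makes the form a quadratic polynomial; the
facts below on single entries come from choosing the step [c]. *)
Lemma qform_deltaD (R : realType) (n : nat) (X : 'M[R]_n) (v : 'rV[R]_n)
    (j : 'I_n) (c : R) :
  X^T = X ->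
  qform (v + c *: delta_mx 0 j) X
  = qform v X + c *+ 2 * (v *m X) 0 j + c ^+ 2 * X j j.
Proof.
move=> sX.
have Ej (u : 'rV[R]_n) :
    (u *m X *m (delta_mx 0 j : 'rV_n)^T) 0 0 = (u *m X) 0 j.
  exact: mulmx_deltaT.
have Ev : ((delta_mx 0 j : 'rV_n) *m X *m v^T) 0 0 = (v *m X) 0 j.
  rewrite -Ej -[in RHS]mulmxA -[in LHS](trmxK (delta_mx 0 j)).
  rewrite -[Z in _ *m Z *m v^T]sX.
  by rewrite -!trmx_mul [LHS]mxE.
rewrite /qform linearD /= linearZ /= !mulmxDl !mulmxDr -!scalemxAl -!scalemxAr.
have eD (P Q : 'M[R]_1) : (P + Q) 0 0 = P 0 0 + Q 0 0 by rewrite mxE.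
have eZ a (P : 'M[R]_1) : (a *: P) 0 0 = a * P 0 0 by rewrite mxE.
have Ee : ((delta_mx 0 j : 'rV_n) *m X) 0 j = X j j by rewrite -rowE mxE.
rewrite !(eD, eZ) !Ej Ev Ee; ring.
Qed.

Lemma qform_delta (R : realType) (n : nat) (X : 'M[R]_n) (i : 'I_n) :
  qform (delta_mx 0 i) X = X i i.
Proof. by rewrite /qform mulmx_deltaT -rowE mxE. Qed.

Lemma psd_diag_ge0 (R : realType) (n : nat) (X : 'M[R]_n) (i : 'I_n) :
  psd X -> 0 <= X i i.
Proof. by move=> [_ /(_ (delta_mx 0 i))]; rewrite qform_delta. Qed.

(** The form at [e_i + e_j] and at [e_i - e_j] bounds twice the entry by
[X i i + X j j]. *)
Lemma psd_entry_le_trace (R : realType) (n : nat) (X : 'M[R]_n) (i j : 'I_n) :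
  psd X -> `|X i j| <= \tr X.
Proof.
move=> pX; have dX k := psd_diag_ge0 k pX.
have [<-|ij] := eqVneq i j.
  rewrite ger0_norm // /mxtrace (bigD1 i) //= lerDl.
  by apply: sumr_ge0 => k _; exact: dX.
have: X i i + X j j <= \tr X.
  have ji : j != i by rewrite eq_sym.
  rewrite /mxtrace (bigD1 i) //= (bigD1 j) //= addrA lerDl.
  by apply: sumr_ge0 => k _; exact: dX.
apply: le_trans.
case: pX => sX pX.
have E : ((delta_mx 0 i : 'rV_n) *m X) 0 j = X i j by rewrite -rowE mxE.
have := pX (delta_mx 0 i + 1 *: delta_mx 0 j).
have := pX (delta_mx 0 i + (-1) *: delta_mx 0 j).
rewrite !qform_deltaD // E qform_delta ler_norml.
have := dX i; have := dX j; lra.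
Qed.

Lemma psd_diag_eq0 (R : realType) (n : nat) (X : 'M[R]_n) (i j : 'I_n) :
  psd X -> X j j = 0 -> X i j = 0.
Proof.
move=> [sX pX] Xj0; apply/eqP; apply: contraT => Xij.
(* along the line through [e_i] in direction [e_j] the form is affine; the step
   is where it takes the value -1 *)
have := pX (delta_mx 0 i + (- (X i i + 1) / (X i j *+ 2)) *: delta_mx 0 j).
rewrite qform_deltaD // qform_delta Xj0 mulr0 addr0 -rowE mxE.
rewrite (_ : _ + _ = -1) ?oppr_ge0 ?ler10 //.
by rewrite mulr2n; field.
Qed.

(** Gaussian elimination step: subtracting the rank-one matrix built from a
column with positive diagonal entry completes the square in the form, hence
keeps it nonnegative, and clears one more diagonal entry. *)
Lemma psd_deflate (R : realType) (n : nat) (X : 'M[R]_n) (i : 'I_n) :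
  psd X -> X i i != 0 ->
  psd (X - (X i i)^-1 *: (col i X *m (col i X)^T)).
Proof.
move=> [sX pX] Xi0; split.
  by rewrite linearB /= linearZ /= trmx_mul trmxK sX.
move=> v.
have := pX (v + (- ((v *m X) 0 i / X i i)) *: delta_mx 0 i).
rewrite qform_deltaD //.
have -> : X - (X i i)^-1 *: (col i X *m (col i X)^T)
    = (- (X i i)^-1) *: (col i X *m (col i X)^T) + X by rewrite scaleNr addrC.
rewrite qform_linear.
rewrite (_ : qform v (col i X *m _) = ((v *m X) 0 i) ^+ 2); last first.
  rewrite /qform mulmxA -mulmxA -trmx_mul.
  by rewrite colE mulmxA -colE mxE big_ord1 !mxE expr2.
move=> h; apply: le_trans h _; rewrite -subr_ge0 (_ : _ - _ = 0) //.
by rewrite mulr2n; field.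
Qed.

(** Completing squares one column at a time ends at the zero matrix, since the
number of nonzero diagonal entries drops at each step. *)
Lemma psd_rank1_decomp (R : realType) (n : nat) (X : 'M[R]_n) :
  psd X -> exists s : seq 'cV[R]_n, X = \sum_(w <- s) w *m w^T.
Proof.
have [k] := ubnP #|[pred i | X i i != 0]|; elim: k X => // k IH X Xk pX.
have [i Xi0|X0] := pickP [pred i | X i i != 0]; last first.
  exists [::]; rewrite big_nil; apply/matrixP => i j; rewrite [RHS]mxE.
  by apply: psd_diag_eq0 => //; apply/eqP; have /negbFE := X0 j.
have pY := psd_deflate pX Xi0; set Y := (X in psd X) in pY.
have Yj j : Y j j = X j j - (X i i)^-1 * X j i ^+ 2.
  by rewrite !mxE big_ord1 !mxE expr2.
have Yi : Y i i = 0 by rewrite Yj; field.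
have [s Ys] : exists s : seq 'cV[R]_n, Y = \sum_(w <- s) w *m w^T.
  apply: IH pY; rewrite -ltnS; apply: leq_trans Xk; rewrite ltnS.
  apply: proper_card; apply/properP; split.
    apply/fintype.subsetP => j; rewrite !inE; apply: contraNneq => Xj.
    have Xji : X j i = 0.
      by case: (pX) => sX _; rewrite -sX mxE; exact: psd_diag_eq0.
    by rewrite Yj Xj Xji expr0n mulr0 subr0.
  by exists i; rewrite !inE ?Yi ?eqxx.
exists ((Num.sqrt (X i i)^-1 *: col i X) :: s).
rewrite big_cons -Ys linearZ /= -scalemxAl -scalemxAr scalerA -expr2 sqr_sqrtr.
  by rewrite /Y addrCA subrr addr0.
by rewrite invr_ge0 psd_diag_ge0.
Qed.

(** With [X] a sum of squares [w w^T], the double sum in [block_row_tens]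
becomes a sum of congruences of [Y]: this is the positivity of
the Kronecker product seen through the block row. *)
Lemma psd_block_row_tens (R : realType) (n k : nat) (M : 'I_k -> 'M[R]_n)
    (X : 'M[R]_k) (Y : 'M[R]_n) :
  psd X -> psd Y -> psd (block_row M *m (X *t Y) *m (block_row M)^T).
Proof.
move=> /psd_rank1_decomp[s ->] pY.
rewrite block_row_tens.
rewrite (_ : (\sum_i _)%R =
  \sum_(w <- s) (\sum_i w i 0 *: M i) *m Y *m (\sum_i w i 0 *: M i)^T).
  by apply: psd_sum => w _; exact: psd_congr.
under eq_bigr do under eq_bigr do rewrite summxE scaler_suml.
under eq_bigr do rewrite exchange_big /=.
rewrite exchange_big /=; apply: eq_bigr => w _.
rewrite linear_sum /= !mulmx_suml; apply: eq_bigr => i _.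
rewrite mulmx_sumr; apply: eq_bigr => j _.
rewrite linearZ /= -!scalemxAl -scalemxAr scalerA.
by rewrite mxE big_ord1 mxE.
Qed.

(** * Norm and convergence of matrices *)

Lemma mx_entry_le_norm (R : realType) (a b : nat) (X : 'M[R]_(a, b)) i j :
  `|X i j| <= `|X|.
Proof.
rewrite [leRHS]/Num.Def.normr/= mx_normrE.
exact: (le_bigmax _ (fun ij : 'I_a * 'I_b => `|X ij.1 ij.2|) (i, j)).
Qed.

Lemma mx_norm_le (R : realType) (a b : nat) (X : 'M[R]_(a, b)) (e : R) :
  0 <= e -> (forall i j, `|X i j| <= e) -> `|X| <= e.
Proof.
move=> e0 Xe; rewrite /Num.Def.normr/= mx_normrE.
by apply: bigmax_le => // -[i j] _; exact: Xe.
Qed.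

Lemma linear_mx_bounded (R : realType) (a b c d : nat)
    (F : {linear 'M[R]_(a, b) -> 'M[R]_(c, d)}) :
  exists2 K : R, 0 <= K & forall X, `|F X| <= K * `|X|.
Proof.
exists (\sum_i \sum_j `|F (delta_mx i j)|).
  by do 2!apply: sumr_ge0 => ? _.
move=> X; rewrite {1}[X]matrix_sum_delta linear_sum /= mulr_suml.
apply: le_trans (ler_norm_sum _ _ _) _; apply: ler_sum => i _.
rewrite linear_sum /= mulr_suml.
apply: le_trans (ler_norm_sum _ _ _) _; apply: ler_sum => j _.
by rewrite linearZ normrZ mulrC ler_wpM2l // mx_entry_le_norm.
Qed.

Lemma linear_mx_continuous (R : realType) (a b c d : nat)
    (F : {linear 'M[R]_(a, b) -> 'M[R]_(c, d)}) : continuous F.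
Proof.
have [K K0 FK] := linear_mx_bounded F.
move=> X; have FX := nbhs_filter (X : 'M[R]_(a, b)).
apply/cvgrPdist_lt => e e0.
have K1 : 0 < K + 1 by rewrite ltr_wpDl.
near=> Y; rewrite -linearB; apply: le_lt_trans (FK _) _.
have XY : `|X - Y| < e / (K + 1).
  near: Y; have /cvgrPdist_lt := @cvg_id _ (nbhs X).
  by apply; rewrite divr_gt0.
apply: le_lt_trans (_ : (K + 1) * `|X - Y| < e).
  by rewrite ler_wpM2r // lerDl.
by rewrite mulrC -ltr_pdivlMr.
Unshelve. all: by end_near. Qed.

Lemma mx_cvg_entries (R : realType) (a b : nat) (T : Type) (G : set_system T)
    {FG : Filter G} (f : T -> 'M[R]_(a, b)) (X : 'M[R]_(a, b)) :
  f x @[x --> G] --> X <-> forall i j, f x i j @[x --> G] --> X i j.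
Proof.
split=> [fX i j|fX].
  apply/cvgrPdist_le => e e0; move/cvgrPdist_le: fX => /(_ e e0).
  apply: filterS => x; apply: le_trans.
  by have := mx_entry_le_norm (X - f x) i j; rewrite !mxE.
apply/cvgrPdist_le => e e0; near=> x.
apply: mx_norm_le (ltW e0) _ => i j; rewrite !mxE.
suff: forall ij : 'I_a * 'I_b, `|X ij.1 ij.2 - f x ij.1 ij.2| <= e.
  by move/(_ (i, j)).
near: x; apply: filter_forall => -[i' j'] /=.
exact: cvgr_dist_le.
Unshelve. all: by end_near. Qed.

(** * A comparison principle for initial value problems *)

(** Induction on the half-line: the supremum of the times up to which [P] holds
cannot be finite. *)
Lemma real_induction (R : realType) (P : R -> Prop) :
  P 0 ->
  (forall t, 0 <= t -> P t -> \forall h \near 0^'+, P (t + h)) ->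
  (forall t, 0 < t -> (forall s, 0 <= s < t -> P s) -> P t) ->
  forall t, 0 <= t -> P t.
Proof.
move=> P0 Pright Pleft T T0; apply: contrapT => nPT.
pose A := [set t | 0 <= t /\ forall s, 0 <= s <= t -> P s].
have A0 : A 0 by split=> // s; rewrite -eq_le => /eqP <-.
have AT : ubound A T.
  move=> t [_ At]; rewrite leNgt; apply/negP => /ltW Tt.
  by apply: nPT; apply: At; rewrite T0.
have supA : has_sup A by split; [exists 0|exists T].
have c0 : 0 <= sup A by apply: ub_le_sup => //; exists T.
have Pc s : 0 <= s < sup A -> P s.
  move=> /andP[s0 sc]; have [t [_ At] st] := sup_gt (ex_intro _ _ A0) sc.
  by apply: At; rewrite s0 ltW.
have PsupA : P (sup A).
  by case: (ltgtP 0 (sup A)) c0 => // [c1|<-] _ //; exact: Pleft.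
have [/= d d0 Pd] := Pright _ c0 PsupA.
have : A (sup A + d / 2).
  split=> [|s /andP[s0 sd]]; first by rewrite addr_ge0 // divr_ge0 // ltW.
  have [sc|cs|->] := ltgtP s (sup A); [by apply: Pc; rewrite s0| |by []].
  rewrite -(subrKC (sup A) s); apply: Pd; rewrite /= ?subr_gt0 // sub0r normrN.
  rewrite gtr0_norm ?subr_gt0 // ltrBlDl; apply: le_lt_trans sd _.
  by rewrite ltrD2l; lra.
have /ub_le_sup/[apply] : has_ubound A by exists T.
by rewrite gerDl; apply/negP; rewrite -ltNge divr_gt0.
Qed.

Lemma ivp_right_continuous (R : realType) (n : nat) (F : 'M[R]_n -> 'M[R]_n)
    (X0 : 'M[R]_n) (f : R -> 'M[R]_n) :
  solves_ivp F X0 f -> f h @[h --> 0^'+] --> X0.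
Proof. by move=> [<- /continuous_within_itvcyP[]]. Qed.

Lemma ivp_continuous (R : realType) (n : nat) (F : 'M[R]_n -> 'M[R]_n)
    (X0 : 'M[R]_n) (f : R -> 'M[R]_n) (t : R) :
  solves_ivp F X0 f -> 0 < t -> {for t, continuous f}.
Proof.
move=> [_ /continuous_within_itvcyP[fc _] _] t0.
by apply: fc; rewrite in_itv /= t0.
Qed.

(** The comparison argument only steps forward in time, hence the one-sided
first order expansion. *)
Lemma ivp_euler (R : realType) (n : nat) (F : 'M[R]_n -> 'M[R]_n)
    (X0 : 'M[R]_n) (f : R -> 'M[R]_n) (t e : R) :
  solves_ivp F X0 f -> 0 < t -> 0 < e ->
  \forall h \near 0^'+, `|f (t + h) - (f t + h *: F (f t))| <= h * e.
Proof.
move=> [_ _ fd] t0 e0; have [/cvg_ex[/= l fl] fF] := fd _ t0.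
have {fF}lF : l = F (f t).
  by rewrite -fF; apply/esym/cvg_lim.
move/cvgrPdist_le: fl => /(_ e e0) /= fle.
have : \forall h \near (0 : R)^'+, `|l - h^-1 *: (f (h *: 1 + t) - f t)| <= e.
  rewrite near_withinE in fle; rewrite near_withinE.
  by apply: filterS fle => h hle h0; apply: hle; rewrite gt_eqF.
apply: filter_app; near=> h => hle.
have h0 : 0 < h by near: h; exact: nbhs_right_gt.
have -> : f (t + h) - (f t + h *: F (f t))
    = - h *: (l - h^-1 *: (f (h *: 1 + t) - f t)).
  rewrite scalerBr !scaleNr opprK scalerA divff ?gt_eqF // scale1r lF.
  by rewrite [h *: 1]mulr1 [h + t]addrC opprD addrA addrC.
by rewrite normrZ normrN gtr0_norm // ler_wpM2l // ltW.
Unshelve. all: by end_near.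
Qed.

(** Real induction on the strict barrier [e * exp ((l + 1) t) * w v].  The
assumption on Euler steps says that they make a bound [g v <= M * w v] grow no
faster than [M * (1 + h l)] to first order in [h]; the spare growth rate 1 of the
barrier absorbs the second order term and the error of the Euler step, and [e]
is arbitrary.  The weights [w] make these errors uniform in [v], which replaces
compactness of the set of functionals. *)
Lemma ivp_comparison (R : realType) (n : nat) (I : Type)
    (F : 'M[R]_n -> 'M[R]_n) (g : I -> 'M[R]_n -> R) (w : I -> R) (l : R)
    (X0 : 'M[R]_n) (f : R -> 'M[R]_n) :
  (forall v a X Y, g v (a *: X + Y) = a * g v X + g v Y) ->
  (forall v, 0 <= w v) ->
  (forall v X, g v X <= w v * `|X|) ->
  0 <= l ->
  (forall X M, 0 <= M -> (forall v, g v X <= M * w v) ->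
     exists2 k, 0 <= k & forall h v, 0 < h ->
       g v (X + h *: F X) <= (M * (1 + h * l) + h ^+ 2 * k) * w v) ->
  solves_ivp F X0 f ->
  (forall v, g v X0 <= 0) ->
  forall t v, 0 <= t -> g v (f t) <= 0.
Proof.
move=> glin w0 gw l0 gF fivp gX0.
have gD v X Y : g v (X + Y) = g v X + g v Y.
  by rewrite -{1}[X]scale1r glin mul1r.
suff H e : 0 < e -> forall t, 0 <= t ->
    forall v, g v (f t) <= e * expR ((l + 1) * t) * w v.
  move=> t v t0; apply/ler_addgt0Pr => e e0; rewrite add0r.
  (* the summand 1 keeps [c] invertible when [w v = 0] *)
  pose c := expR ((l + 1) * t) * w v + 1.
  have c0 : 0 < c by rewrite ltr_wpDl // mulr_ge0 ?expR_ge0.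
  apply: le_trans (H (e / c) _ t t0 v) _; first by rewrite divr_gt0.
  rewrite (_ : _ * w v = e * ((c - 1) / c)); last first.
    by rewrite /c addrK; ring.
  by rewrite ger_pMr // ler_pdivrMr // mul1r gerBl.
move=> e0; apply: real_induction.
- move=> v; case: fivp => -> _ _.
  by apply: le_trans (gX0 v) _; rewrite !mulr_ge0 ?expR_ge0 // ltW.
- move=> t; rewrite le_eqVlt => /predU1P[<- _|t0 Pt].
    have := ivp_right_continuous fivp => /cvgrPdist_le /(_ e e0).
    apply: filter_app; near=> h => fh v.
    have h0 : 0 < h by near: h; exact: nbhs_right_gt.
    rewrite add0r -[f h](subrK X0) gD.
    apply: le_trans (_ : w v * `|f h - X0| + 0 <= _).
      by apply: lerD => //; exact: gw.
    rewrite addr0 distrC mulrC ler_wpM2r //; apply: le_trans fh _.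
    apply: ler_peMr; first exact: ltW.
    apply: le_trans (expR_ge1Dx _).
    by rewrite lerDl mulr_ge0 ?addr_ge0 // ltW.
  set M := e * expR ((l + 1) * t) in Pt.
  have M0 : 0 < M by rewrite mulr_gt0 ?expR_gt0.
  have [k k0 gk] := gF _ _ (ltW M0) Pt.
  have M2 : 0 < M / 2 by rewrite divr_gt0.
  have := ivp_euler fivp t0 M2; apply: filter_app; near=> h => fh v.
  have h0 : 0 < h by near: h; exact: nbhs_right_gt.
  have hk : h * k <= M / 2.
    apply: le_trans (_ : h * (k + 1) <= _).
      by rewrite ler_wpM2l ?ltW // ltrDl.
    rewrite -ler_pdivlMr ?ltr_wpDl //; apply: ltW; near: h.
    by apply: nbhs_right_lt; rewrite divr_gt0 // ltr_wpDl.
  rewrite -[f _](subrK (f t + h *: F (f t))) gD mulrDr expRD mulrA -/M.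
  apply: le_trans (lerD (gw _ _) (gk h v h0)) _.
  apply: le_trans (_ : (M * (1 + h * (l + 1))) * w v <= _); last first.
    apply: ler_wpM2r => //; apply: ler_wpM2l; first exact: ltW.
    by rewrite [h * _]mulrC; exact: expR_ge1Dx.
  rewrite [w v * _]mulrC -mulrDl ler_wpM2r //.
  have := lerD fh (ler_wpM2l (ltW h0) hk); lra.
- move=> t t0 Ps v.
  have : (fun s => e * expR ((l + 1) * s) * w v - g v (f s)) @ t^'- -->
      e * expR ((l + 1) * t) * w v - g v (f t).
    apply: cvg_at_left_filter; apply: cvgB.
      apply: cvgM; last exact: cvg_cst.
      apply: cvgM; first exact: cvg_cst.
      apply: continuous_comp; last exact: continuous_expR.
      by apply: cvgM; [exact: cvg_cst|exact: cvg_id].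
    apply/cvgrPdist_le => d d0.
    have wd : 0 < d / (w v + 1) by rewrite divr_gt0 // ltr_wpDl.
    have /cvgrPdist_le /(_ _ wd) := ivp_continuous fivp t0.
    apply: filterS => s fs.
    have gB X Y : g v X - g v Y = g v (X - Y).
      have -> : X - Y = (-1) *: Y + X by rewrite scaleN1r addrC.
      by rewrite glin mulN1r addrC.
    have dw : w v * (d / (w v + 1)) <= d.
      by rewrite mulrCA ger_pMr // ler_pdivrMr ?ltr_wpDl // mul1r lerDl.
    rewrite ler_norml gB lerNl; apply/andP; split; last first.
      by apply: le_trans (gw _ _) (le_trans _ dw); rewrite ler_wpM2l.
    rewrite -gB opprB gB.
    by apply: le_trans (gw _ _) (le_trans _ dw); rewrite ler_wpM2l // distrC.
  move=> flim; rewrite -subr_ge0.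
  rewrite -(cvg_lim (@Rhausdorff R) flim).
  apply: limr_ge; first exact: cvgP flim.
  near=> s; rewrite /= subr_ge0; apply: Ps; apply/andP; split.
    by apply: ltW; near: s; exact: nbhs_left_gt.
  by near: s; exact: nbhs_left_lt.
Unshelve. all: by end_near. Qed.

(** * The Lyapunov flow preserves positive semidefinite matrices *)

Lemma qform_norm_le (R : realType) (n : nat) (v : 'rV[R]_n) (X : 'M[R]_n) :
  `|qform v X| <= n%:R * (\sum_i v 0 i ^+ 2) * `|X|.
Proof.
rewrite qformE.
apply: le_trans (_ : \sum_i \sum_j (v 0 i ^+ 2 + v 0 j ^+ 2) / 2 * `|X| <= _).
  apply: le_trans (ler_norm_sum _ _ _) _; apply: ler_sum => i _.
  apply: le_trans (ler_norm_sum _ _ _) _; apply: ler_sum => j _.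
  rewrite normrM; apply: ler_pM => //; last exact: mx_entry_le_norm.
  rewrite ler_norml; apply/andP; split.
    have := sqr_ge0 (v 0 i + v 0 j); lra.
  have := sqr_ge0 (v 0 i - v 0 j); lra.
under eq_bigr do rewrite -mulr_suml -mulr_suml big_split /= sumr_const card_ord.
rewrite -!mulr_suml big_split /= sumrMnl sumr_const card_ord mulr_natl.
by rewrite -mulr2n -[X in X / 2 * _]mulr_natr mulfK.
Qed.

Lemma qform1 (R : realType) (n : nat) (v : 'rV[R]_n) :
  qform v 1%:M = \sum_i v 0 i ^+ 2.
Proof.
by rewrite /qform mulmx1 mxE; apply: eq_bigr => i _; rewrite mxE expr2.
Qed.

(** Completing the square: up to second order in [h], an Euler step of the flow
is a sum of congruences of [Y], and congruences keep the form nonnegative. *)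
Lemma reach_op_euler_square (R : realType) (n m : nat) (A : 'M[R]_n)
    (N : 'I_m -> 'M[R]_n) (Y : 'M[R]_n) (h : R) :
  Y + h *: reach_op A N Y
  = (- h ^+ 2) *: (A *m Y *m A^T)
    + (h *: (\sum_k N k *m Y *m (N k)^T)
       + (1%:M + h *: A) *m Y *m (1%:M + h *: A)^T).
Proof.
have -> : (1%:M + h *: A)^T = 1%:M + h *: A^T.
  by rewrite linearD /= linearZ /= trmx1.
rewrite reach_opE !mulmxDl !mulmxDr !mul1mx !mulmx1.
rewrite -!scalemxAl -!scalemxAr !scalerDr.
rewrite scalerA -expr2 scaleNr.
move: (h *: (A *m Y)) (h *: (Y *m A^T)) (h *: \sum_k _) (_ ^+ 2 *: _).
move=> a b c d.
by apply/matrixP => i j; rewrite !mxE; ring.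
Qed.

Lemma reach_flow_qform_ge0 (R : realType) (n m : nat) (A : 'M[R]_n)
    (N : 'I_m -> 'M[R]_n) (X0 : 'M[R]_n) (f : R -> 'M[R]_n) :
  solves_ivp (reach_op A N) X0 f -> (forall v, 0 <= qform v X0) ->
  forall t v, 0 <= t -> 0 <= qform v (f t).
Proof.
move=> fivp X00 t v t0; rewrite -oppr_le0; move: t v t0.
pose s (v : 'rV[R]_n) := \sum_i v 0 i ^+ 2.
have s0 v : 0 <= s v by apply: sumr_ge0 => i _; exact: sqr_ge0.
pose L1 := reach_op A N 1%:M.
apply: (ivp_comparison (g := fun v X => - qform v X) (w := fun v => n%:R * s v)
  (l := n%:R * `|L1|) _ _ _ _ _ fivp).
- by move=> v a X Y; rewrite qform_linear opprD mulrN.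
- by move=> v; rewrite mulr_ge0.
- move=> v X; apply: le_trans (qform_norm_le _ _).
  by rewrite -normrN ler_norm.
- by rewrite mulr_ge0.
- move=> X M M0 XM.
  (* shifting by a multiple of the identity turns the bound into [Y >= 0] *)
  pose Y := M * n%:R *: 1%:M + X.
  have Y0 v : 0 <= qform v Y.
    by have := XM v; rewrite /Y qform_linear qform1 -/(s v); lra.
  exists `|A *m Y *m A^T| => // h v h0.
  have -> : X + h *: reach_op A N X
      = (- (M * n%:R)) *: (h *: L1 + 1%:M) + (Y + h *: reach_op A N Y).
    rewrite /Y reach_op_is_linear -/L1.
    move: (reach_op A N X) L1 (1%:M : 'M[R]_n) => LX L1' E.
    by apply/matrixP => i j; rewrite !mxE; ring.
  rewrite !qform_linear qform1 -/(s v) reach_op_euler_square !qform_linear.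
  have q1 : 0 <= qform v ((1%:M + h *: A) *m Y *m (1%:M + h *: A)^T).
    by rewrite qform_congr.
  have q2 : 0 <= h * qform v (\sum_k N k *m Y *m (N k)^T).
    apply: mulr_ge0; first exact: ltW.
    rewrite /qform mulmx_sumr mulmx_suml summxE.
    by apply: sumr_ge0 => k _; have := Y0 (v *m N k); rewrite -qform_congr.
  have q3 : h ^+ 2 * qform v (A *m Y *m A^T)
      <= h ^+ 2 * (n%:R * s v * `|A *m Y *m A^T|).
    rewrite ler_wpM2l ?sqr_ge0 //; apply: le_trans (qform_norm_le _ _).
    exact: ler_norm.
  have q4 : M * n%:R * (h * qform v L1)
      <= M * n%:R * (h * (n%:R * s v * `|L1|)).
    apply: ler_wpM2l; first exact: mulr_ge0.
    apply: ler_wpM2l; first exact: ltW.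
    by apply: le_trans (qform_norm_le _ _); exact: ler_norm.
  lra.
- by move=> v; rewrite oppr_le0.
Qed.

(** The functionals [X i j - X j i] satisfy the comparison principle because the
operator commutes with transposition, hence acts on the antisymmetric part. *)
Lemma reach_flow_sym (R : realType) (n m : nat) (A : 'M[R]_n)
    (N : 'I_m -> 'M[R]_n) (X0 : 'M[R]_n) (f : R -> 'M[R]_n) :
  solves_ivp (reach_op A N) X0 f -> X0^T = X0 ->
  forall t, 0 <= t -> (f t)^T = f t.
Proof.
move=> fivp sX0 t t0.
suff H (ij : 'I_n * 'I_n) : f t ij.1 ij.2 - f t ij.2 ij.1 <= 0.
  apply/matrixP => i j; rewrite mxE; apply/eqP; rewrite eq_le.
  by rewrite -subr_le0 (H (j, i)) -subr_le0 (H (i, j)).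
have [K K0 LK] := linear_mx_bounded (reach_op A N).
move: t ij t0.
apply: (ivp_comparison
  (g := fun (ij : 'I_n * 'I_n) (X : 'M[R]_n) => X ij.1 ij.2 - X ij.2 ij.1)
  (w := fun=> 2) (l := K) _ _ _ _ _ fivp) => //.
- by move=> [i j] a X Y; rewrite !mxE /=; ring.
- move=> [i j] X /=; have := mx_entry_le_norm X i j.
  have := mx_entry_le_norm X j i; rewrite !ler_norml; lra.
- move=> X M M0 XM; exists 0 => // h [i j] h0 /=.
  pose D := X - X^T.
  have DM : `|D| <= M * 2.
    apply: mx_norm_le => [|i' j']; first lra.
    rewrite !mxE ler_norml; have := XM (i', j'); have := XM (j', i') => /=.
    lra.
  have -> : (X + h *: reach_op A N X) i j - (X + h *: reach_op A N X) j i
      = D i j + h * reach_op A N D i j.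
    by rewrite /D linearB /= -reach_op_tr !mxE; ring.
  have d1 := le_trans (ler_norm _) (le_trans (mx_entry_le_norm D i j) DM).
  have d2 : h * reach_op A N D i j <= h * (K * (M * 2)).
    apply: ler_wpM2l; first exact: ltW.
    apply: le_trans (ler_norm _) _.
    apply: le_trans (mx_entry_le_norm _ _ _) _.
    by apply: le_trans (LK _) _; rewrite ler_wpM2l.
  lra.
- by move=> [i j] /=; rewrite -[in X in _ - X]sX0 mxE subrr.
Qed.

Lemma reach_flow_psd (R : realType) (n m : nat) (A : 'M[R]_n)
    (N : 'I_m -> 'M[R]_n) (X0 : 'M[R]_n) (f : R -> 'M[R]_n) (t : R) :
  solves_ivp (reach_op A N) X0 f -> psd X0 -> 0 <= t -> psd (f t).
Proof.
move=> fivp [sX0 X00] t0; split; first exact: reach_flow_sym fivp sX0 t t0.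
by move=> v; exact: reach_flow_qform_ge0 fivp X00 t v t0.
Qed.

(** * Time integrals of solutions *)

Lemma ivp_comp_continuous (R : realType) (n : nat) (F : 'M[R]_n -> 'M[R]_n)
    (X0 : 'M[R]_n) (Z : R -> 'M[R]_n) (phi : 'M[R]_n -> R) :
  solves_ivp F X0 Z -> continuous phi ->
  {within `[0, +oo[%classic, continuous (fun s => phi (Z s))}.
Proof.
move=> Zivp cphi; apply/continuous_within_itvcyP; split.
  move=> t; rewrite in_itv /= andbT => t0.
  apply: (@continuous_comp _ _ _ Z phi); last exact: cphi.
  exact: ivp_continuous Zivp t0.
have [Z0 _ _] := Zivp; rewrite Z0.
by apply: continuous_cvg (ivp_right_continuous Zivp); exact: cphi.
Qed.

Lemma ivp_integrable (R : realType) (n : nat) (F : 'M[R]_n -> 'M[R]_n)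
    (X0 : 'M[R]_n) (Z : R -> 'M[R]_n) (a b : R) i j :
  solves_ivp F X0 Z -> 0 <= a ->
  lebesgue_measure.-integrable `[a, b]%classic
    (EFin \o (fun s => Z s i j : R)).
Proof.
move=> Zivp a0; apply: continuous_compact_integrable.
  exact: segment_compact.
have Zc := ivp_comp_continuous Zivp (@coord_continuous _ _ _ i j).
apply: continuous_subspaceW Zc => s /=; rewrite !in_itv /= andbT.
by case/andP => /(le_trans a0).
Qed.

Lemma Rintegral_lincomb (R : realType) (I : Type) (r : seq I) (D : set R)
    (c : I -> R) (f : I -> R -> R) :
  measurable (D : set (measurableTypeR R)) ->
  (forall k, lebesgue_measure.-integrable D (EFin \o f k)) ->
  \int[lebesgue_measure]_(s in D) (\sum_(k <- r) c k * f k s)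
  = \sum_(k <- r) c k * \int[lebesgue_measure]_(s in D) f k s.
Proof.
move=> mD fi.
have ci k : lebesgue_measure.-integrable D (EFin \o (fun s => c k * f k s)).
  rewrite (_ : _ \o _ = (fun s => (c k)%:E * (f k s)%:E)%E).
    exact: (integrableZl mD (c k) (fi k)).
  by apply/funext => s /=; rewrite EFinM.
have si t : lebesgue_measure.-integrable D
    (EFin \o (fun s => \sum_(k <- t) c k * f k s)).
  rewrite (_ : _ \o _ = (fun s => \sum_(k <- t) (c k * f k s)%:E)%E).
    by apply: integrable_sum => // k _; exact: ci.
  by apply/funext => s /=; rewrite sumEFin.
elim: r => [|k r IH].
  under eq_Rintegral do rewrite big_nil.
  by rewrite Rintegral_cst // mul0r big_nil.
under eq_Rintegral do rewrite big_cons.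
by rewrite (RintegralD mD (ci k) (si r)) (RintegralZl _ mD (fi k)) IH big_cons.
Qed.

Lemma int_to_psd (R : realType) (n : nat) (T : R) (Z : R -> 'M[R]_n) :
  (forall i j, lebesgue_measure.-integrable `[0, T]%classic
     (EFin \o (fun s => Z s i j : R))) ->
  (forall t, 0 <= t -> psd (Z t)) -> psd (int_to T Z).
Proof.
move=> Zi Zpsd; split.
  apply/matrixP => i j; rewrite !mxE; apply: eq_Rintegral => s.
  rewrite inE /= in_itv /= => /andP[s0 _].
  by have [sZ _] := Zpsd s s0; rewrite -[in LHS]sZ mxE.
move=> v; rewrite qformE pair_bigA /=.
under eq_bigr do rewrite mxE.
rewrite -(@Rintegral_lincomb R _ _ _ (fun p => v 0 p.1 * v 0 p.2)
  (fun p s => Z s p.1 p.2)) //.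
apply: Rintegral_ge0 => s /=; rewrite in_itv /= => /andP[s0 _].
have [_ /(_ v)] := Zpsd s s0.
by rewrite qformE pair_bigA.
Qed.

(** The fundamental theorem of calculus entry by entry; [F] leaves the integral
because it is a fixed linear combination of entries. *)
Lemma ivp_integral (R : realType) (n : nat) (F : {linear 'M[R]_n -> 'M[R]_n})
    (X0 : 'M[R]_n) (Z : R -> 'M[R]_n) (T : R) :
  solves_ivp F X0 Z -> 0 < T -> Z T = X0 + F (int_to T Z).
Proof.
move=> Zivp T0; apply/matrixP => i j; rewrite mxE.
pose c (p : 'I_n * 'I_n) := F (delta_mx p.1 p.2) i j.
have Fij X : F X i j = \sum_p c p * X p.1 p.2.
  rewrite {1}[X]matrix_sum_delta linear_sum summxE.
  under eq_bigr do rewrite linear_sum summxE.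
  rewrite pair_bigA /=; apply: eq_bigr => p _.
  by rewrite linearZ mxE mulrC.
apply/eqP; rewrite -subr_eq0 opprD addrA subr_eq0; apply/eqP.
rewrite Fij; under eq_bigr do rewrite mxE.
rewrite -(@Rintegral_lincomb R _ _ _ c (fun p s => Z s p.1 p.2)) //; last first.
  by move=> p; exact: ivp_integrable Zivp _.
under eq_Rintegral do rewrite -Fij.
have [Z0 _ Zd] := Zivp.
have Zij (t : R) : 0 < t -> is_derive t 1 (fun s => Z s i j) (F (Z t) i j).
  move=> t0; have [Zt ZtF] := Zd t t0.
  split; first by move/derivable_mxP: Zt; apply.
  by rewrite -ZtF derive_mx // mxE.
have coordc := @coord_continuous R n n i j.
rewrite /Rintegral (@continuous_FTC2 _ _ (fun s => Z s i j)) //.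
- by rewrite Z0.
- have FZc : continuous (fun X => F X i j).
    move=> X; apply: (@continuous_comp _ _ _ F (fun Y : 'M[R]_n => Y i j)).
      exact: linear_mx_continuous.
    exact: coordc.
  apply: continuous_subspaceW (ivp_comp_continuous Zivp FZc) => s /=.
  by rewrite !in_itv /= andbT => /andP[].
- split=> [t||].
  + rewrite in_itv /= => /andP[t0 _]; by case: (Zij t t0).
  + have /continuous_within_itvcyP[_] := ivp_comp_continuous Zivp coordc.
    by [].
  + have /continuous_within_itvcyP[cZ _] := ivp_comp_continuous Zivp coordc.
    by apply: cvg_at_left_filter; apply: cZ; rewrite in_itv /= T0.
- move=> t; rewrite in_itv /= => /andP[t0 _].
  by rewrite derive1E; case: (Zij t t0).
Qed.

(** * Cauchy products and series of matrices *)

Lemma triangle_sum (R : realType) (f : nat -> nat -> R) (K : nat) :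
  \sum_(1 <= i < K.+1) \sum_(1 <= k < i) f k (i - k)%N
  = \sum_(1 <= k < K.+1) \sum_(1 <= l < K.+1 | (k + l <= K)%N) f k l.
Proof.
transitivity (\sum_(1 <= i < K.+1) \sum_(1 <= k < K.+1 | (k < i)%N)
    f k (i - k)%N).
  by apply: eq_big_nat => i /andP[_ iK]; apply: big_nat_widen; exact: ltnW.
rewrite (exchange_big_dep_nat xpredT) //=.
apply: eq_big_nat => k /andP[k1 kK].
rewrite -(big_nat_widenl k.+1 1 _ xpredT) // -add1n big_addn.
under eq_bigr do rewrite addnK.
rewrite (big_nat_widen 1 (K.+1 - k) K.+1) ?leq_subr //.
by apply: eq_bigl => l; rewrite ltn_subRL ltnS.
Qed.

Lemma leq_half_self K : (K./2 <= K)%N.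
Proof. by rewrite -[leqRHS]odd_double_half -addnn addnA leq_addl. Qed.

Lemma cvg_half_index (R : realType) (u : nat -> R) (l : R) :
  u k @[k --> \oo] --> l -> u k./2 @[k --> \oo] --> l.
Proof.
move=> ul; apply: cvg_comp ul => A [N _ NA]; exists N.*2 => // k /= Nk.
by apply: NA => /=; rewrite -[N]doubleK half_leq.
Qed.

(** The square partial sum minus the triangular one is a sum over [k + l > K],
dominated by the same sum for the majorants.  As the triangle contains the square
of half the side, the latter sum is at most the difference of two square partial
sums of the majorants, which have the same limit. *)
Lemma cauchy_product_sum (R : realType) (x y a b : nat -> R) (X Y sa sb : R) :
  (forall k, (1 <= k)%N -> `|x k| <= a k) ->
  (forall k, (1 <= k)%N -> `|y k| <= b k) ->
  (\sum_(1 <= k < K.+1) x k) @[K --> \oo] --> X ->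
  (\sum_(1 <= k < K.+1) y k) @[K --> \oo] --> Y ->
  (\sum_(1 <= k < K.+1) a k) @[K --> \oo] --> sa ->
  (\sum_(1 <= k < K.+1) b k) @[K --> \oo] --> sb ->
  (\sum_(1 <= i < K.+1) \sum_(1 <= k < i) x k * y (i - k)%N)
    @[K --> \oo] --> X * Y.
Proof.
move=> xa yb cx cy ca cb.
pose S (u : nat -> R) K := \sum_(1 <= k < K.+1) u k.
pose C (u v : nat -> R) K :=
  \sum_(1 <= k < K.+1) \sum_(1 <= l < K.+1 | (k + l <= K)%N) u k * v l.
pose D (u v : nat -> R) K :=
  \sum_(1 <= k < K.+1) \sum_(1 <= l < K.+1 | ~~ (k + l <= K)%N) u k * v l.
have SCD u v K : S u K * S v K = C u v K + D u v K.
  rewrite /S /C /D mulr_suml -big_split /=; apply: eq_bigr => k _.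
  by rewrite mulr_sumr (bigID (fun l => k + l <= K)%N).
have a0 k : (1 <= k)%N -> 0 <= a k by move/xa; exact: le_trans.
have b0 k : (1 <= k)%N -> 0 <= b k by move/yb; exact: le_trans.
have DD K : `|D x y K| <= D a b K.
  apply: le_trans (ler_norm_sum _ _ _) _; apply: ler_sum_nat => k /andP[k1 _].
  apply: le_trans (ler_norm_sum _ _ _) _.
  rewrite big_nat_cond [leRHS]big_nat_cond; apply: ler_sum => l.
  by case/andP => /andP[l1 _] _; rewrite normrM ler_pM ?xa ?yb.
(* the square of side [K./2] lies in the triangle [k + l <= K] *)
have Dle K : D a b K <= S a K * S b K - S a K./2 * S b K./2.
  rewrite SCD addrAC lerDr subr_ge0 /C /S.
  rewrite (big_nat_widen 1 _ K.+1) ?ltnS ?leq_half_self //.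
  rewrite (big_nat_widen 1 _ K.+1 _ b) ?ltnS ?leq_half_self //.
  rewrite big_mkcond mulr_suml.
  apply: ler_sum_nat => k /andP[k1 _].
  rewrite big_mkcond mulr_sumr [leRHS]big_mkcond.
  apply: ler_sum_nat => l /andP[l1 _] /=; rewrite !ltnS.
  have ab0 : 0 <= a k * b l by rewrite mulr_ge0 ?a0 ?b0.
  case: ifP => kK; last by rewrite mul0r; case: ifP.
  case: ifP => lK; last by rewrite mulr0; case: ifP.
  rewrite ifT //; apply: leq_trans (leq_add kK lK) _.
  by rewrite addnn -[leqRHS]odd_double_half leq_addl.
have D0 : D x y K @[K --> \oo] --> 0.
  apply/norm_cvg0P.
  apply: (squeeze_cvgr (f := cst 0)
    (h := fun K => S a K * S b K - S a K./2 * S b K./2)).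
  - by near=> K; rewrite normr_ge0 /=; exact: le_trans (DD K) (Dle K).
  - exact: cvg_cst.
  - rewrite -(subrr (sa * sb)); apply: cvgB; apply: cvgM => //.
      exact: cvg_half_index ca.
    exact: cvg_half_index cb.
have -> : (fun K : nat => \sum_(1 <= i < K.+1) \sum_(1 <= k < i)
    x k * y (i - k)%N) = (fun K => S x K * S y K - D x y K).
  apply/funext => K; rewrite SCD addrK.
  exact: (triangle_sum (fun k l => x k * y l)).
rewrite -[X * Y]subr0; apply: cvgB => //; exact: cvgM.
Unshelve. all: by end_near. Qed.

Lemma is_sum_entries (R : realType) (n : nat) (u : nat -> 'M[R]_n)
    (S : 'M[R]_n) :
  is_sum u S <->
  forall i j, (\sum_(1 <= k < K.+1) u k i j) @[K --> \oo] --> S i j.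
Proof.
rewrite /is_sum mx_cvg_entries.
have E i j : (fun K => (\sum_(1 <= k < K.+1) u k) i j)
    = (fun K => \sum_(1 <= k < K.+1) u k i j).
  by apply/funext => K; rewrite summxE.
by split=> uS i j; have := uS i j; rewrite E.
Qed.

Lemma is_sum_trace (R : realType) (n : nat) (u : nat -> 'M[R]_n)
    (S : 'M[R]_n) :
  is_sum u S -> (\sum_(1 <= k < K.+1) \tr (u k)) @[K --> \oo] --> \tr S.
Proof.
move/is_sum_entries => uS.
under eq_fun do rewrite /mxtrace exchange_big.
by apply: cvg_big => //=; exact: add_continuous.
Qed.

(** Positive semidefinite terms make both series absolutely convergent, being
dominated entrywise by the traces. *)
Lemma is_sum_tens (R : realType) (n : nat) (u v : nat -> 'M[R]_n)
    (U V : 'M[R]_n) :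
  (forall k, (1 <= k)%N -> psd (u k)) -> (forall k, (1 <= k)%N -> psd (v k)) ->
  is_sum u U -> is_sum v V ->
  is_sum (fun i => \sum_(1 <= k < i) (u k *t v (i - k)%N)) (U *t V).
Proof.
move=> pu pv uU vV; apply/is_sum_entries => i j.
case: (mxtens_indexP i) => i1 i2; case: (mxtens_indexP j) => j1 j2.
rewrite tensmxE.
under eq_fun do under eq_bigr do rewrite summxE.
under eq_fun do under eq_bigr do under eq_bigr do rewrite tensmxE.
apply: (cauchy_product_sum (x := fun k => u k i1 j1) (y := fun k => v k i2 j2)
  (a := fun k => \tr (u k)) (b := fun k => \tr (v k))).
- by move=> k k1; exact: psd_entry_le_trace (pu k k1).
- by move=> k k1; exact: psd_entry_le_trace (pv k k1).
- by move/is_sum_entries: uU; apply.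
- by move/is_sum_entries: vV; apply.
- exact: is_sum_trace uU.
- exact: is_sum_trace vV.
Qed.

Lemma is_sum_linear (R : realType) (a b : nat) (F : {linear 'M[R]_a -> 'M[R]_b})
    (u : nat -> 'M[R]_a) (S : 'M[R]_a) :
  is_sum u S -> is_sum (F \o u) (F S).
Proof.
move=> uS; rewrite /is_sum.
under eq_fun do rewrite /= -linear_sum.
by apply: continuous_cvg uS; exact: linear_mx_continuous.
Qed.

Lemma is_sumD (R : realType) (n : nat) (u v : nat -> 'M[R]_n) (U V : 'M[R]_n) :
  is_sum u U -> is_sum v V -> is_sum (fun i => u i + v i) (U + V).
Proof.
move=> uU vV; rewrite /is_sum; under eq_fun do rewrite big_split.
exact: cvgD.
Qed.

Lemma is_sum_first (R : realType) (n : nat) (X : 'M[R]_n) :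
  is_sum (fun i => if i == 1%N then X else 0) X.
Proof.
rewrite /is_sum -cvg_shiftS /=.
rewrite (_ : (fun K => _) = cst X); first exact: cvg_cst.
apply/funext => K /=; rewrite big_ltn // eqxx big_nat_cond big1 ?addr0 //.
by move=> i /andP[/andP[i1 _] _]; rewrite gtn_eqF.
Qed.

Lemma eq_is_sum (R : realType) (n : nat) (u v : nat -> 'M[R]_n) (S : 'M[R]_n) :
  (forall i, (1 <= i)%N -> u i = v i) -> is_sum u S -> is_sum v S.
Proof.
move=> uv; rewrite /is_sum; under eq_fun do under eq_big_nat => i /andP[i1 _]
  do rewrite (uv i i1).
by [].
Qed.

Lemma is_sum_unique (R : realType) (n : nat) (u : nat -> 'M[R]_n)
    (S S' : 'M[R]_n) :
  is_sum u S -> is_sum u S' -> S = S'.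
Proof. by apply: cvg_unique; exact: norm_hausdorff. Qed.

(** * Infinite horizon *)

Lemma psd_closed (R : realType) (n : nat) (T : Type) (G : set_system T)
    {FG : ProperFilter G} (f : T -> 'M[R]_n) (X : 'M[R]_n) :
  f x @[x --> G] --> X -> (forall x, psd (f x)) -> psd X.
Proof.
move=> fX fpsd; have /mx_cvg_entries fXij := fX; split.
  apply/matrixP => i j; rewrite mxE.
  have E : (fun x => f x j i) = (fun x => f x i j).
    by apply/funext => x; have [sfx _] := fpsd x; rewrite -[in LHS]sfx mxE.
  have := fXij j i; rewrite E => /(cvg_lim (@Rhausdorff R)) <-.
  by rewrite (cvg_lim (@Rhausdorff R) (fXij i j)).
move=> v.
have cq : qform v (f x) @[x --> G] --> qform v X.
  rewrite (qformE v X) (_ : (fun x => _) =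
    (fun x => \sum_i \sum_j v 0 i * v 0 j * f x i j)).
    apply: cvg_big => [|i _]; first exact: add_continuous.
    apply: cvg_big => [|j _]; first exact: add_continuous.
    by apply: cvgM; [exact: cvg_cst|exact: fXij].
  by apply/funext => x; rewrite qformE.
rewrite -(cvg_lim (@Rhausdorff R) cq); apply: limr_ge; first exact: cvgP cq.
by near=> x; have [_] := fpsd x; apply.
Unshelve. all: by end_near. Qed.

(** The integral over [T, T + 1] tends to 0, as a difference of two convergent
integrals, and also to the limit of the integrand. *)
Lemma ivp_limit_0 (R : realType) (n : nat) (F : 'M[R]_n -> 'M[R]_n)
    (X0 V : 'M[R]_n) (Z : R -> 'M[R]_n) :
  solves_ivp F X0 Z -> int_infty_cvg Z -> Z t @[t --> +oo] --> V -> V = 0.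
Proof.
move=> Zivp /mx_cvg_entries Icvg /mx_cvg_entries Zcvg.
apply/matrixP => i j; rewrite mxE.
have {Icvg} := Icvg i j; have {Zcvg} := Zcvg i j.
move: (V i j) (int_infty Z i j) => l I Zl II.
apply/normr0_eq0/eqP; rewrite eq_le normr_ge0 andbT.
apply/ler_addgt0Pr => e e0; rewrite add0r.
have e3 : 0 < e / 3 by rewrite divr_gt0.
have [a [_ Za]] := (cvgrPdist_le _ _).1 Zl _ e3.
have [b [_ Ib]] := (cvgrPdist_le _ _).1 II _ e3.
(* a nonnegative time beyond which both estimates hold *)
pose c := Num.max 0 (Num.max a b) + 1.
have c0 : 0 <= c by rewrite addr_ge0 // le_max lexx.
have ac : a < c by rewrite ltr_pwDr // !le_max lexx !orbT.
have bc : b < c by rewrite ltr_pwDr // !le_max lexx !orbT.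
have Zi a' b' := @ivp_integrable _ _ _ _ _ a' b' i j Zivp.
have diff : int_to (c + 1) Z i j - int_to c Z i j
    = \int[lebesgue_measure]_(s in `]c, (c + 1)]%classic) Z s i j.
  rewrite !mxE; apply: Rintegral_itvB; first exact: Zi.
    by rewrite bnd_simp.
  by rewrite bnd_simp lerDl.
have ci k : lebesgue_measure.-integrable `]c, (c + 1)]%classic
    (EFin \o (fun=> k : R)).
  apply: (@integrableS _ _ _ lebesgue_measure `[c, (c + 1)]%classic) => //.
    exact: subset_itv_oc_cc.
  apply: continuous_compact_integrable; first exact: segment_compact.
  by move=> x; exact: cvg_cst.
have Zci : lebesgue_measure.-integrable `]c, (c + 1)]%classic
    (EFin \o (fun s => Z s i j : R)).
  apply: integrableS (Zi _ (c + 1) c0) => //.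
  exact: subset_itv_oc_cc.
have cstI k : \int[lebesgue_measure]_(s in `]c, (c + 1)]%classic) k = k :> R.
  rewrite Rintegral_cst //= lebesgue_measure_itv /= lte_fin ltrDl ltr01.
  by rewrite -EFinB /= addrAC subrr add0r mulr1.
have up : int_to (c + 1) Z i j - int_to c Z i j <= l + e / 3.
  rewrite diff -[leRHS]cstI; apply: le_Rintegral => // s /=.
  rewrite in_itv /= => /andP[cs _].
  by have := Za s (lt_trans ac cs); rewrite ler_norml; lra.
have lo : l - e / 3 <= int_to (c + 1) Z i j - int_to c Z i j.
  rewrite diff -[leLHS]cstI; apply: le_Rintegral => // s /=.
  rewrite in_itv /= => /andP[cs _].
  by have := Za s (lt_trans ac cs); rewrite ler_norml; lra.
have := Ib _ bc; have : b < c + 1 by lra.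
move/Ib; rewrite !ler_norml; lra.
Qed.

Lemma ivp_integral_infty (R : realType) (n : nat)
    (F : {linear 'M[R]_n -> 'M[R]_n}) (X0 : 'M[R]_n) (Z : R -> 'M[R]_n) :
  solves_ivp F X0 Z -> int_infty_cvg Z -> 0 = X0 + F (int_infty Z).
Proof.
move=> Zivp Zcvg; apply/esym; apply: (ivp_limit_0 Zivp Zcvg).
have FI : X0 + F (int_to t Z) @[t --> +oo] --> X0 + F (int_infty Z).
  apply: cvgD; first exact: cvg_cst.
  by apply: continuous_cvg Zcvg; exact: linear_mx_continuous.
apply: cvg_trans FI; apply: near_eq_cvg; near=> t.
by rewrite (ivp_integral Zivp).
Unshelve. all: by end_near. Qed.

(** * The terms of the Gramians *)

(** Induction along the recursion: the initial value of a term involves only the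
integrals of earlier terms.  The time integration [J] is abstract to treat finite
and infinite horizons at once. *)
Lemma reach_terms_psd (R : realType) (n m : nat) (A : 'M[R]_n)
    (B : 'M[R]_(n, m)) (N : 'I_m -> 'M[R]_n) (H : 'I_n -> 'M[R]_n)
    (J : (R -> 'M[R]_n) -> 'M[R]_n) (Z : nat -> R -> 'M[R]_n) :
  reach_terms A B N H J Z ->
  (forall i X0, (1 <= i)%N -> solves_ivp (reach_op A N) X0 (Z i) ->
     psd X0 -> psd (J (Z i))) ->
  forall i, (1 <= i)%N -> psd (J (Z i)).
Proof.
move=> [Z1 Zi] JZ; elim/ltn_ind => -[//|[|i]] IH _.
  exact: JZ Z1 (psd_gram B).
apply: JZ (Zi _ _) _ => //.
rewrite mulmx_sumr mulmx_suml big_nat; apply: psd_sum => k /andP[k1 ki].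
apply: psd_block_row_tens; apply: IH => //.
  by rewrite ltn_subrL k1.
by rewrite subn_gt0.
Qed.

Lemma obs_terms_psd (R : realType) (n m p : nat) (A : 'M[R]_n)
    (C : 'M[R]_(p, n)) (N : 'I_m -> 'M[R]_n) (H : 'I_n -> 'M[R]_n)
    (J : (R -> 'M[R]_n) -> 'M[R]_n) (Z W : nat -> R -> 'M[R]_n) :
  obs_terms A C N H J Z W ->
  (forall i, (1 <= i)%N -> psd (J (Z i))) ->
  (forall i X0, (1 <= i)%N -> solves_ivp (obs_op A N) X0 (W i) ->
     psd X0 -> psd (J (W i))) ->
  forall i, (1 <= i)%N -> psd (J (W i)).
Proof.
move=> [W1 Wi] pZ JW; elim/ltn_ind => -[//|[|i]] IH _.
  apply: JW W1 _ => //; rewrite -[X in _ *m X]trmxK; exact: psd_gram.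
apply: JW (Wi _ _) _ => //.
rewrite mulmx_sumr mulmx_suml big_nat; apply: psd_sum => k /andP[k1 ki].
apply: psd_block_row_tens; first exact: pZ.
apply: IH; first by rewrite ltn_subrL k1.
by rewrite subn_gt0.
Qed.

(** Both assertions of the theorem in one form: [E i] is [W i T] for a finite
horizon and 0 for the infinite one. *)
Lemma obs_terms_sum (R : realType) (n m p : nat) (A : 'M[R]_n)
    (C : 'M[R]_(p, n)) (N : 'I_m -> 'M[R]_n) (H : 'I_n -> 'M[R]_n)
    (J : (R -> 'M[R]_n) -> 'M[R]_n) (Z W : nat -> R -> 'M[R]_n)
    (E : nat -> 'M[R]_n) (P Q : 'M[R]_n) :
  obs_terms A C N H J Z W ->
  (forall i, (1 <= i)%N -> psd (J (Z i))) ->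
  (forall i, (1 <= i)%N -> psd (J (W i))) ->
  (forall i X0, (1 <= i)%N -> solves_ivp (obs_op A N) X0 (W i) ->
     E i = X0 + obs_op A N (J (W i))) ->
  is_sum (fun i => J (Z i)) P -> is_sum (fun i => J (W i)) Q ->
  is_sum E (C^T *m C + block_tr H *m (P *t Q) *m (block_tr H)^T + obs_op A N Q).
Proof.
move=> [W1 Wi] pZ pW EW ZP WQ.
pose Phi := mulmxr (block_tr H)^T \o mulmx (block_tr H).
have S1 := @is_sum_first R n (C^T *m C).
have S2 := @is_sum_linear _ _ _ Phi _ _ (is_sum_tens pZ pW ZP WQ).
have S3 := @is_sum_linear _ _ _ (reach_op A^T (fun k => (N k)^T)) _ _ WQ.
have S4 := @is_sumD _ _ _ _ _ _ (@is_sumD _ _ _ _ _ _ S1 S2) S3.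
rewrite obs_op_dual; apply: (@eq_is_sum _ _ _ _ _ _ S4).
case=> [//|[|i]] _ /=; rewrite -obs_op_dual.
  by rewrite big_geq // mulmx0 mul0mx addr0 (EW _ _ _ W1).
by rewrite add0r (EW _ _ _ (Wi i.+2 _)).
Qed.

Lemma reach_int_to_psd (R : realType) (n m : nat) (A : 'M[R]_n)
    (N : 'I_m -> 'M[R]_n) (X0 : 'M[R]_n) (Y : R -> 'M[R]_n) (T : R) :
  solves_ivp (reach_op A N) X0 Y -> psd X0 -> psd (int_to T Y).
Proof.
move=> Yivp pX0; apply: int_to_psd => [i j|t t0].
  exact: ivp_integrable Yivp _.
exact: reach_flow_psd Yivp pX0 t0.
Qed.

Lemma reach_int_infty_psd (R : realType) (n m : nat) (A : 'M[R]_n)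
    (N : 'I_m -> 'M[R]_n) (X0 : 'M[R]_n) (Y : R -> 'M[R]_n) :
  solves_ivp (reach_op A N) X0 Y -> int_infty_cvg Y -> psd X0 ->
  psd (int_infty Y).
Proof.
move=> Yivp Ycvg pX0; apply: psd_closed Ycvg _ => T.
exact: reach_int_to_psd Yivp pX0.
Qed.

Theorem proposition3p5 (R : realType) (n m p : nat)
    (A : 'M[R]_n) (B : 'M[R]_(n, m)) (C : 'M[R]_(p, n))
    (N : 'I_m -> 'M[R]_n) (H : 'I_n -> 'M[R]_n) :
  (forall (T : R) (Z W : nat -> R -> 'M[R]_n) (P Q : 'M[R]_n),
     0 < T ->
     reach_terms A B N H (int_to T) Z ->
     obs_terms A C N H (int_to T) Z W ->
     is_sum (fun i => int_to T (Z i)) P ->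
     is_sum (fun i => int_to T (W i)) Q ->
     exists2 S : 'M[R]_n,
       is_sum (fun i => W i T) S &
       S - C^T *m C
       = obs_op A N Q + block_tr H *m (P *t Q) *m (block_tr H)^T) /\
  (forall (Z W : nat -> R -> 'M[R]_n) (P Q : 'M[R]_n),
     spectrum (A *t (1%:M : 'M[R]_n) + (1%:M : 'M[R]_n) *t A
               + \sum_(k < m) N k *t N k) `<=` @open_left_half_plane R ->
     reach_terms A B N H (@int_infty R n) Z ->
     (forall i : nat, (1 <= i)%N -> int_infty_cvg (Z i)) ->
     is_sum (fun i => int_infty (Z i)) P ->
     obs_terms A C N H (@int_infty R n) Z W ->
     (forall i : nat, (1 <= i)%N -> int_infty_cvg (W i)) ->
     is_sum (fun i => int_infty (W i)) Q ->
     - (C^T *m C)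
     = obs_op A N Q + block_tr H *m (P *t Q) *m (block_tr H)^T).
Proof.
split=> [T Z W P Q T0 HZ HW ZP WQ|Z W P Q _ HZ Zcvg ZP HW Wcvg WQ].
- have pZ : forall i, (1 <= i)%N -> psd (int_to T (Z i)).
    by apply: reach_terms_psd HZ _ => i X0 _; exact: reach_int_to_psd.
  have pW : forall i, (1 <= i)%N -> psd (int_to T (W i)).
    apply: obs_terms_psd HW pZ _ => i X0 _.
    by rewrite obs_op_dual; exact: reach_int_to_psd.
  exists (C^T *m C + block_tr H *m (P *t Q) *m (block_tr H)^T + obs_op A N Q).
    apply: obs_terms_sum HW pZ pW _ ZP WQ => i X0 _.
    by rewrite obs_op_dual => Wi; exact: ivp_integral Wi T0.
  by rewrite addrAC (addrAC (C^T *m C)) subrr add0r addrC.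
- have pZ : forall i, (1 <= i)%N -> psd (int_infty (Z i)).
    apply: reach_terms_psd HZ _ => i X0 i1 Zi.
    exact: reach_int_infty_psd Zi (Zcvg i i1).
  have pW : forall i, (1 <= i)%N -> psd (int_infty (W i)).
    apply: obs_terms_psd HW pZ _ => i X0 i1.
    by rewrite obs_op_dual => Wi; exact: reach_int_infty_psd Wi (Wcvg i i1).
  have S0 : is_sum (fun=> 0)
      (C^T *m C + block_tr H *m (P *t Q) *m (block_tr H)^T + obs_op A N Q).
    apply: obs_terms_sum HW pZ pW _ ZP WQ => i X0 i1.
    by rewrite obs_op_dual => Wi; exact: ivp_integral_infty Wi (Wcvg i i1).
  have S0' : is_sum (fun=> 0) (0 : 'M[R]_n).
    rewrite /is_sum; under eq_fun do rewrite big1 //.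
    exact: cvg_cst.
  have /eqP := is_sum_unique S0 S0'.
  by rewrite -addrA addr_eq0 [_ + obs_op _ _ _]addrC => /eqP ->; rewrite opprK.
Qed.
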